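(* Let $k\ge3$ and $1\le r\le k-1$ be integers, and let $B=(X,Y;E)$ be a bipartite graph with parts $X,Y$, edge set $E$, and girth greater than $2k$. Then $B[r]$ is $C_{2k}$-free. Suppose further that there are fixed-point-free involutions $\alpha_X$ of $X$ and $\alpha_Y$ of $Y$ satisfying (i) for all $x\in X$, $y\in Y$: $xy\in E$ if and only if $\alpha_X(x)\alpha_Y(y)\in E$; and (ii) no $x\in X$ is adjacent to both $y$ and $\alpha_Y(y)$ for any $y\in Y$. Then there is a simple signed graph $\widehat Q$ whose underlying graph is bipartite, with $$\mathrm{DC}(\widehat Q)\cong B[r],\qquad v(\widehat Q)=\frac{r|X|+|Y|}{2},\qquad e(\widehat Q)=\frac{r\,e(B)}{2}.$$ In particular, $\widehat Q$ is $C_{+2k}$-free.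
   Context: All graphs are finite and simple; $v(\cdot)$ and $e(\cdot)$ denote the numbers of vertices and edges. The girth of a graph without cycles is $\infty$. A graph is $C_{2k}$-free if it contains no cycle of length $2k$ as a subgraph. For a bipartite graph $B=(X,Y;E)$, the one-sided $r$-clone $B[r]$ is obtained by replacing each $x\in X$ by $r$ pairwise nonadjacent vertices $x_1,\dots,x_r$, each with the same neighbours in $Y$ as $x$. A signed graph is a pair $\widehat G=(G,\sigma)$ with underlying graph $G$ and $\sigma:E(G)\to\{+1,-1\}$. The sign of a cycle is the product of its edge signs; $\widehat G$ is $C_{+2k}$-free if it has no $2k$-cycle of sign $+1$. The double cover $\mathrm{DC}(\widehat G)$ is the ordinary graph on $\{v^+:v\in V(G)\}\sqcup\{v^-:v\in V(G)\}$ in which each positive edge $uv$ gives the edges $u^+v^+$ and $u^-v^-$, and each negative edge $uv$ gives the edges $u^+v^-$ and $u^-v^+$. *)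

(* Defs.v *)
From HB Require Import structures.
From mathcomp Require Import all_boot all_order all_algebra.

Set Implicit Arguments.
Unset Strict Implicit.
Unset Printing Implicit Defensive.

Import GRing.Theory.

Record sgraph := SGraph {
  vertex :> finType;
  adj : rel vertex;
  adj_sym : symmetric adj;
  adj_irr : irreflexive adj }.

Definition edges (G : sgraph) : {set {set G}} :=
  [set [set u; v] | u in G, v in G & adj u v].

Definition vertex_num (G : sgraph) : nat := #|G|.
Definition edge_num (G : sgraph) : nat := #|edges G|.

(* The bound [2 < size c] excludes the empty sequence and the back-and-forth
   walks [:: u; v], which [ucycleb] accepts. *)
Definition is_cycle (G : sgraph) (c : seq G) : bool :=
  (2 < size c) && ucycleb (@adj G) c.

Definition has_cycle (G : sgraph) (l : nat) : bool :=
  [exists c : l.-tuple G, is_cycle c].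

Definition cycle_free (l : nat) (G : sgraph) : Prop := ~~ has_cycle G l.

(* [None] stands for infinity; a cycle of [G] has length at most [#|G|], so
   the head of the filtered increasing list is the length of a shortest one. *)
Definition girth (G : sgraph) : option nat :=
  ohead [seq l <- iota 0 #|G|.+1 | has_cycle G l].

Definition girth_gt (n : nat) (G : sgraph) : Prop :=
  if girth G is Some g then n < g else True.

Lemma has_cycleP (G : sgraph) (l : nat) :
  reflect (exists2 c : seq G, is_cycle c & size c = l) (has_cycle G l).
Proof.
apply: (iffP existsP) => [[c Hc]|[c Hc <-]]; first by exists c; rewrite ?size_tuple.
by exists (in_tuple c).
Qed.

Lemma girth_gtP (G : sgraph) (n : nat) :
  girth_gt n G <-> (forall c : seq G, is_cycle c -> n < size c).
Proof.
have Hin (c : seq G) : is_cycle c ->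
    size c \in [seq l <- iota 0 #|G|.+1 | has_cycle G l].
  move=> Hc; rewrite mem_filter mem_iota /= add0n ltnS; apply/andP; split.
    by apply/has_cycleP; exists c.
  by case/and3P: Hc => _ _ Hu; rewrite -(card_uniqP Hu) max_card.
rewrite /girth_gt /girth; case Es: (filter _ _) Hin => [|g s] Hin /=.
  by split=> // _ c /Hin.
have := sorted_filter ltn_trans (has_cycle G) (iota_ltn_sorted 0 #|G|.+1).
rewrite Es /= (path_sortedE ltn_trans) => /andP[/allP Hs _].
split=> [Hn c /Hin|H].
  by rewrite inE => /predU1P[->//|/Hs]; apply: ltn_trans.
have: g \in [seq l <- iota 0 #|G|.+1 | has_cycle G l] by rewrite Es mem_head.
by rewrite mem_filter => /andP[/has_cycleP[c Hc <-] _]; apply: H.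
Qed.

Definition sg_iso (G H : sgraph) : Prop :=
  exists2 f : G -> H, bijective f & forall u v, adj (f u) (f v) = adj u v.

Definition bipartite (G : sgraph) : Prop :=
  exists p : G -> bool, forall u v, adj u v -> p u != p v.

Section Bip.
Variables (X Y : finType) (E : X -> Y -> bool).

Definition bip_adj : rel (X + Y) := fun u v =>
  match u, v with
  | inl x, inr y | inr y, inl x => E x y
  | _, _ => false
  end.

Fact bip_adj_sym : symmetric bip_adj. Proof. by case=> u [] v. Qed.
Fact bip_adj_irr : irreflexive bip_adj. Proof. by case. Qed.

Definition bip_graph : sgraph := SGraph bip_adj_sym bip_adj_irr.
End Bip.

Definition clone (X Y : finType) (E : X -> Y -> bool) (r : nat) : sgraph :=
  bip_graph (fun (xi : X * 'I_r) (y : Y) => E xi.1 y).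

(* Signs are functions of the unordered pair {u, v}; the values of [sgn] on
   sets that are not edges are irrelevant. *)
Record signed_graph := SignedGraph {
  underlying :> sgraph;
  sgn : {set underlying} -> int;
  sgn_pm1 : forall e, e \in edges underlying -> sgn e = 1%R \/ sgn e = (-1)%R }.

Definition cycle_sign (Q : signed_graph) (c : seq Q) : int :=
  (\prod_(u <- c) sgn [set u; next c u])%R.

Definition pos_cycle_free (l : nat) (Q : signed_graph) : Prop :=
  forall c : seq Q, is_cycle c -> size c = l -> cycle_sign c <> 1%R.

Section DoubleCover.
Variable Q : signed_graph.

(* (v, true) is v^+ and (v, false) is v^-. *)
Definition dc_adj : rel (Q * bool) := fun p q =>
  adj p.1 q.1 &&
  (sgn [set p.1; q.1] == (if p.2 == q.2 then 1 else -1)%R).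

Fact dc_adj_sym : symmetric dc_adj.
Proof. by move=> p q; rewrite /dc_adj adj_sym (setUC [set p.1]) (eq_sym p.2). Qed.
Fact dc_adj_irr : irreflexive dc_adj.
Proof. by move=> p; rewrite /dc_adj adj_irr. Qed.

Definition double_cover : sgraph := SGraph dc_adj_sym dc_adj_irr.
End DoubleCover.

(* Main.v *)
Require Import Defs.
From mathcomp Require Import all_boot all_order all_algebra.

(** Project a [2k]-cycle of [B[r]] to a closed walk in [B], written as a cyclic
    list of pairs [(x_i, y_i)] with [y_i] adjacent to [x_i] and [x_(i+1)].  The
    [y_i] are distinct.  If the [x_i] are not all equal, cutting the walk at a
    repeated [x] leaves a shorter closed walk that is still not constant in [x];
    once no [x] repeats we have a cycle of [B] of length at most [2k].  If they
    are all equal, the cycle uses [k > r] clones of one vertex.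

    For the second part, [Q] is the quotient of [B[r]] by the involution
    [(x_i, y) |-> (aX x_i, aY y)]; the sign of an edge records whether it joins
    the chosen orbit representatives.  A positive cycle of [Q] lifts to a cycle
    of the same length in the double cover. *)

Set Implicit Arguments.
Unset Strict Implicit.
Unset Printing Implicit Defensive.

Import GRing.Theory.

(** * Closed walks in a bipartite graph *)

Section ZigZag.
Variables (X Y : finType) (E : X -> Y -> bool).

Definition zigzag : rel (X * Y) := fun p q => E p.1 p.2 && E q.1 p.2.

Fixpoint interleave (s : seq (X * Y)) : seq (X + Y) :=
  if s is p :: s' then [:: inl p.1, inr p.2 & interleave s'] else [::].

Lemma size_interleave s : size (interleave s) = 2 * size s.
Proof. by elim: s => //= p s ->; rewrite mulnS. Qed.

Lemma mem_interleave s u :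
  u \in interleave s =
  match u with inl x => x \in unzip1 s | inr y => y \in unzip2 s end.
Proof. by case: u => u; elim: s => //= p s IHs; rewrite !inE IHs. Qed.

Lemma uniq_interleave s :
  uniq (interleave s) = uniq (unzip1 s) && uniq (unzip2 s).
Proof.
elim: s => //= p s ->; rewrite inE /= !mem_interleave.
by rewrite -!andbA; congr (_ && _); rewrite andbCA.
Qed.

Lemma path_interleave p s x y :
  path (bip_adj E) (inl p.1) (inr p.2 :: rcons (interleave s) (inl x)) =
  path zigzag p (rcons s (x, y)).
Proof.
elim: s p => [|q s IHs] p /=; first by rewrite /zigzag -andbA.
by have /= -> := IHs q; rewrite /zigzag -andbA.
Qed.

Lemma cycle_interleave s : cycle (bip_adj E) (interleave s) = cycle zigzag s.
Proof.
case: s => [|p s] //.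
by have := path_interleave p s p.1 p.2; rewrite -surjective_pairing.
Qed.

Lemma interleave_path x c :
  path (bip_adj E) (inl x) (rcons c (inl x)) ->
  exists s, inl x :: c = interleave s.
Proof.
(* The end point stays fixed while the start advances two vertices at a time, hence the separate
   generalisation and the strong induction on size. *)
move: {2}x; have [n] := ubnP (size c).
elim: n c x => // n IHn [|[//|y] [|[x'|y'] c]] x //= Hn z.
- by exists [:: (x, y)].
- case/and3P=> _ _ Hc; have [|s ->] := IHn c x' _ z Hc; first exact: ltnW.
  by exists ((x, y) :: s).
- by rewrite andbF.
Qed.

Lemma split_nonuniq_unzip1 (s : seq (X * Y)) :
  ~~ uniq (unzip1 s) ->
  exists x y y' s1 s2 s3, s = s1 ++ (x, y) :: s2 ++ (x, y') :: s3.
Proof.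
elim: s => //= -[x y] s IHs; rewrite negb_and negbK => /orP[|/IHs].
  case/mapP=> -[x' y'] /splitPr[s2 s3] /= ->.
  by exists x', y, y', [::], s2, s3.
case=> x1 [y1 [y' [s1 [s2 [s3 ->]]]]].
by exists x1, y1, y', ((x, y) :: s1), s2, s3.
Qed.

Lemma zigzag_cycle s :
  0 < size s -> uniq (unzip2 s) -> cycle zigzag s ->
  (forall x, ~~ all (fun p => p.1 == x) s) ->
  exists2 c : seq (bip_graph E), is_cycle c & size c <= 2 * size s.
Proof.
have [n] := ubnP (size s); elim: n s => // n IHn s /ltnSE Hn s_gt0 Us Cs Ns.
have [U1|] := boolP (uniq (unzip1 s)).
  exists (interleave s); rewrite ?size_interleave // /is_cycle /ucycleb.
  rewrite size_interleave uniq_interleave U1 Us cycle_interleave Cs !andbT.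
  (* A single pair would interleave to a degenerate walk of length 2; it is excluded because it is
     constant in [x]. *)
  case: s s_gt0 Ns {Hn Us Cs U1} => [|p [|q s]] // _ Ns; last by rewrite /= !mulnS.
  by have := Ns p.1; rewrite /= eqxx.
case/split_nonuniq_unzip1=> x [y [y' [s1 [s2 [s3 Es]]]]].
(* The two closed walks obtained by cutting at the occurrences of [x]; together they form a rotation
   of [s]. *)
set t1 := (x, y) :: s2; set t2 := (x, y') :: s3 ++ s1.
have Et : t1 ++ t2 = rot (size s1) s by rewrite Es rot_size_cat /= -catA.
have szt : size t1 + size t2 = size s by rewrite -size_cat Et size_rot.
have Ut : uniq (unzip2 (t1 ++ t2)) by rewrite Et /unzip2 map_rot rot_uniq.
have Ct : cycle zigzag (t1 ++ t2) by rewrite Et rot_cycle.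
(* [zigzag] ignores the [Y] component of its second argument, so returning to [(x, y)] or to
   [(x, y')] is the same condition and both pieces close up. *)
have /andP[C1 C2] : cycle zigzag t1 && cycle zigzag t2.
  move: Ct; rewrite /= rcons_cat cat_path /= => /and3P[].
  by rewrite !rcons_path => -> E1 /andP[-> E2]; apply/andP.
have Nt : ~~ all (fun p => p.1 == x) t1 || ~~ all (fun p => p.1 == x) t2.
  by rewrite -negb_and -all_cat Et (eq_all_r (mem_rot _ _)).
have reduce t z : size t < size s -> uniq (unzip2 t) -> cycle zigzag t ->
    ~~ all (fun p => p.1 == x) t -> (x, z) \in t ->
    exists2 c : seq (bip_graph E), is_cycle c & size c <= 2 * size s.
  move=> st Utt Ctt Ntt xt.
  have [||//|//|x'|c Hc Sc] := IHn t; first exact: leq_trans Hn.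
  - by case: (t) xt.
  (* As [t] visits [x], it could only be constant with value [x]. *)
  - by apply: contra Ntt => /allP/[dup] /(_ _ xt) /= /eqP <- /allP.
  by exists c => //; rewrite (leq_trans Sc) // leq_mul2l ltnW.
move: Ut; rewrite /unzip2 map_cat cat_uniq => /and3P[U1 _ U2].
case/orP: Nt => Nt.
  by apply: (reduce t1 y); rewrite ?mem_head // -szt /= addnS ltnS leq_addr.
by apply: (reduce t2 y'); rewrite ?mem_head // -szt /= addSn ltnS leq_addl.
Qed.
End ZigZag.

(** * Even cycles in the clone *)

Lemma clone_cycle_free (k r : nat) (X Y : finType) (E : X -> Y -> bool) :
  0 < k -> r < k -> girth_gt (2 * k) (bip_graph E) ->
  cycle_free (2 * k) (clone E r).
Proof.
move=> k_gt0 rk /girth_gtP girthE.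
apply/has_cycleP => -[c /andP[_ /andP[Cc Uc]] Sc].
(* One of the first two vertices lies on the [X] side; rotating to it makes the cycle an
   interleaving. *)
have [x c_x] : exists x, inl x \in c.
  case: c Sc Cc {Uc} => [|[x|y] [|[x'|y'] c]] //=.
  - by move/eqP; rewrite eq_sym muln_eq0 /= eqn0Ngt k_gt0.
  - by exists x; rewrite mem_head.
  - by exists x'; rewrite !inE eqxx.
have [i c' Ec] := rot_to c_x.
have [s Es] : exists s, inl x :: c' = interleave s.
  apply: (@interleave_path _ _ (fun (xi : X * 'I_r) (y : Y) => E xi.1 y)).
  by move: Cc; rewrite -(rot_cycle i) Ec.
rewrite -(rot_cycle i) Ec Es cycle_interleave in Cc.
rewrite -(rot_uniq i) Ec Es uniq_interleave in Uc.
have {c_x i c' Ec Es}Sc : size s = k.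
  apply/eqP; rewrite -(eqn_pmul2l (isT : 0 < 2)) -size_interleave -Es -Ec size_rot.
  by rewrite Sc.
case/andP: Uc => U1 U2.
(* Clone indices are forgotten; the [Y] vertices, and so their distinctness, are unchanged. *)
pose t := [seq (p.1.1, p.2) | p <- s].
have [/existsP[x0 /allP Hx0]|/existsPn Nt] :=
    boolP [exists x, all (fun p => p.1 == x) t].
  (* Distinct clones of the single vertex [x0] have distinct indices, giving [k] elements of
     ['I_r]. *)
  have Ux : uniq [seq p.2 | p <- unzip1 s].
    rewrite map_inj_in_uniq // => p q /mapP[p' sp ->] /mapP[q' sq ->] Epq.
    have Hx z : z \in s -> z.1.1 = x0.
      by move=> sz; apply/eqP/(Hx0 (z.1.1, z.2))/mapP; exists z.
    by rewrite [p'.1]surjective_pairing [q'.1]surjective_pairing Epq !Hx.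
  have := max_card [in [seq p.2 | p <- unzip1 s]].
  by rewrite (card_uniqP Ux) !size_map card_ord Sc leqNgt rk.
have [||||c0 Hc0] := @zigzag_cycle _ _ E t.
- by rewrite size_map Sc.
- by rewrite /unzip2 -map_comp.
- by rewrite cycle_map.
- by [].
by rewrite size_map Sc leqNgt girthE.
Qed.

(** * Lifting positive cycles to the double cover *)

Section LiftPositive.
Variable Q : signed_graph.
Local Notation walk_sign u p :=
  (\prod_(e <- pairmap (fun v w : Q => [set v; w]) u p) sgn e)%R.

Lemma cycle_sign_walk u p : uniq (u :: p) ->
  cycle_sign (u :: p) = walk_sign u (rcons p u).
Proof.
(* The closing vertex [u0] is freed from the head so that induction on [p] applies. Since [next_at]
   searches by value, uniqueness is what makes it skip the head. *)
suff walk_next u0 v : uniq (v :: p) ->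
    (\prod_(w <- v :: p) sgn [set w; next_at w u0 v p])%R =
    walk_sign v (rcons p u0).
  exact: walk_next.
elim: p v => [|v' p IHp] v Up; first by rewrite !big_seq1 /= eqxx.
rewrite big_cons [RHS]big_cons -IHp; last by case/andP: Up.
rewrite /= eqxx; congr (_ * _)%R; apply: eq_big_seq => w pw.
by case: eqP pw Up => //= -> ->.
Qed.

(** The lift switches sheets exactly at negative edges, so the sign of the walk compares its first
    and last sheets. *)
Lemma lift_walk u b p : path (@adj Q) u p ->
  exists q, [/\ path (@dc_adj Q) (u, b) q, unzip1 q = p &
    walk_sign u p = (if b == (last (u, b) q).2 then 1 else -1)%R].
Proof.
elim: p u b => [|v p IHp] u b /=.
  by exists [::]; rewrite big_nil eqxx.
case/andP=> uv /IHp lift_p.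
have [b' Eb'] : exists b', sgn [set u; v] = (if b == b' then 1 else -1)%R.
  have: [set u; v] \in edges Q by apply/imset2P; exists u v; rewrite ?inE.
  by case/sgn_pm1=> ->; [exists b | exists (~~ b)]; case: b.
have [q [pq <- Eq]] := lift_p b'.
exists ((v, b') :: q); split=> //=; first by rewrite pq /dc_adj /= uv Eb' eqxx.
by rewrite big_cons Eb' Eq; case: (last _ q).2; case: (b); case: (b').
Qed.

(** A positive sign brings the lift back to its starting sheet, so it closes; its vertices are
    distinct because their projections are. *)
Lemma pos_cycle_lift (c : seq Q) : is_cycle c -> cycle_sign c = 1%R ->
  has_cycle (double_cover Q) (size c).
Proof.
case: c => // u p /and3P[Sc Cc Uc]; rewrite cycle_sign_walk // => pos.
have [q [pq Eq]] := lift_walk true Cc; rewrite pos.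
case/lastP: q pq Eq => [|q [v b]]; first by case: (p).
rewrite /unzip1 map_rcons last_rcons => pq /rcons_inj[Eq Ev]; case: b pq => // pq _.
rewrite Ev in pq; apply/has_cycleP; exists ((u, true) :: q); last by rewrite -Eq /= size_map.
apply/and3P; split=> //; first by rewrite -Eq /= size_map in Sc.
by apply: (@map_uniq _ _ fst); rewrite /= Eq.
Qed.
End LiftPositive.

Lemma has_cycle_iso (G H : sgraph) l : sg_iso G H -> has_cycle G l -> has_cycle H l.
Proof.
case=> f bij_f adj_f /has_cycleP[c /and3P[Sc Cc Uc] Ec].
apply/has_cycleP; exists (map f c); rewrite ?size_map //.
apply/and3P; rewrite size_map map_inj_uniq ?Uc ?Sc; last exact: bij_inj.
by rewrite cycle_map (eq_cycle (e' := @adj G)).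
Qed.

Lemma double_cover_pos_cycle_free (Q : signed_graph) (G : sgraph) l :
  sg_iso (double_cover Q) G -> cycle_free l G -> pos_cycle_free l Q.
Proof.
move=> isoQ freeG c Cc Sc pos; apply/negP: freeG; rewrite negbK.
by apply: has_cycle_iso isoQ _; rewrite -Sc; apply: pos_cycle_lift.
Qed.

(** * Edge counts and orbits of a free involution *)

Lemma edge_num_bip (X Y : finType) (E : X -> Y -> bool) :
  edge_num (bip_graph E) = \sum_x \sum_y E x y.
Proof.
have -> : edge_num (bip_graph E) = #|[set p : X * Y | E p.1 p.2]|.
  rewrite -(card_imset (f := fun p : X * Y => [set inl p.1; inr p.2])).
    congr #|pred_of_set _|; apply/setP=> e; apply/imset2P/imsetP.
      case=> -[x|y] [x'|y'] _; rewrite inE //= => Exy ->.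
        by exists (x, y'); rewrite ?inE.
      by exists (x', y); rewrite ?inE // setUC.
    by case=> -[x y]; rewrite inE /= => Exy ->; exists (inl x) (inr y); rewrite ?inE.
  move=> [x y] [x' y'] /setP eq_e.
  have := eq_e (inl x); have := eq_e (inr y); rewrite !inE !eqxx /= => /esym.
  by move=> /eqP[->] /esym; rewrite orbF => /eqP[->].
by rewrite pair_big -sum1_card big_mkcond; apply: eq_bigr => p _; rewrite inE; case: (E _ _).
Qed.

(** [H] picks from each orbit the element of smaller [enum_rank]; the tag [true] marks this
    representative and [false] its image. *)
Lemma involution_halves (T : finType) (a : T -> T) :
  involutive a -> (forall x, a x <> x) ->
  exists (H : finType) (h : H * bool -> T),
    bijective h /\ forall u b, h (u, ~~ b) = a (h (u, b)).
Proof.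
move=> aK a_free; pose P x := enum_rank x < enum_rank (a x).
pose h (p : {x | P x} * bool) := if p.2 then val p.1 else a (val p.1).
have PN x : P (a x) = ~~ P x.
  rewrite /P aK -leqNgt [RHS]leq_eqVlt [X in X || _]negbTE //.
  by apply/negP=> /eqP/val_inj/enum_rank_inj/a_free.
exists {x | P x}, h; split; last by move=> u []; rewrite /h //= aK.
apply: inj_card_bij => [[u b] [v c]|].
  rewrite /h /=; have Pu : P (sval u) := valP u; have Pv : P (sval v) := valP v.
  case: b c => [] [] E.
  - by rewrite (val_inj E).
  - by rewrite E PN Pv in Pu.
  - by rewrite -E PN Pu in Pv.
  - by rewrite (val_inj (can_inj aK E)).
(* The cardinality bound is obtained from surjectivity: either [x] or [a x] is a representative. *)
rewrite -(size_codom h) cardE uniq_leq_size ?enum_uniq // => x _.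
have [Px|NPx] := boolP (P x); first by apply/codomP; exists (exist _ x Px, true).
rewrite -PN in NPx.
by apply/codomP; exists (exist _ (a x) NPx, false); rewrite /h /= aK.
Qed.

Lemma sum_pair_bool (T : finType) (F : T * bool -> nat) :
  \sum_p F p = \sum_u (F (u, true) + F (u, false)).
Proof.
rewrite (eq_bigr (fun p => F (p.1, p.2))) => [|[]//].
rewrite -(pair_bigA _ (fun u b => F (u, b))).
by apply: eq_bigr => u _; rewrite big_bool.
Qed.

(** * The signed quotient and its double cover *)

Section SignedQuotient.
Variables (X Y X' Y' : finType) (E : X -> Y -> bool).
Variables (hX : X' * bool -> X) (hY : Y' * bool -> Y).
Hypothesis E_neg : forall u v b c,
  E (hX (u, ~~ b)) (hY (v, ~~ c)) = E (hX (u, b)) (hY (v, c)).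
Hypothesis E_simple : forall u v,
  ~~ (E (hX (u, true)) (hY (v, true)) && E (hX (u, true)) (hY (v, false))).

(** By [E_neg], every edge between two orbits has a translate at the representative of [u], so only
    that end is tested. *)
Definition quotient_adj (u : X') (v : Y') : bool :=
  E (hX (u, true)) (hY (v, true)) || E (hX (u, true)) (hY (v, false)).

Definition quotient_sgn (e : {set bip_graph quotient_adj}) : int :=
  if [exists p : X' * Y', (e == [set inl p.1; inr p.2]) &&
        E (hX (p.1, true)) (hY (p.2, true))]
  then 1%R else (-1)%R.

Lemma quotient_sgn_pm1 (e : {set bip_graph quotient_adj}) :
  e \in edges (bip_graph quotient_adj) ->
  quotient_sgn e = 1%R \/ quotient_sgn e = (-1)%R.
Proof. by move=> _; rewrite /quotient_sgn; case: ifP; [left | right]. Qed.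

Definition signed_quotient : signed_graph := SignedGraph quotient_sgn_pm1.

Lemma quotient_sgnE u v :
  quotient_sgn [set inl u; inr v] =
  if E (hX (u, true)) (hY (v, true)) then 1%R else (-1)%R.
Proof.
congr (if _ then _ else _); apply/existsP/idP => [[[u' v'] /andP[/eqP/setP eq_e]]|Euv].
  have := eq_e (inl u); have := eq_e (inr v); rewrite !inE !eqxx /= => /esym/eqP[->].
  by rewrite orbF => /esym/eqP[->].
by exists (u, v); rewrite eqxx.
Qed.

(** By [E_neg] only [b == c] matters; by [E_simple] at most one of the two kinds of edge occurs, so
    the sign tells which. *)
Lemma quotient_adjE u v b c :
  E (hX (u, b)) (hY (v, c)) =
  quotient_adj u v &&
  (quotient_sgn [set inl u; inr v] == (if b == c then 1 else -1)%R).
Proof.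
have -> : E (hX (u, b)) (hY (v, c)) = E (hX (u, true)) (hY (v, b == c)).
  by case: b; case: c; rewrite // -E_neg.
rewrite quotient_sgnE /quotient_adj; have := E_simple u v.
by case: (b == c); case: (E _ (hY (v, true))); case: (E _ (hY (v, false))).
Qed.

Lemma double_cover_quotient :
  bijective hX -> bijective hY ->
  sg_iso (double_cover signed_quotient) (bip_graph E).
Proof.
case=> gX hXK gXK [gY hYK gYK].
pose f (p : double_cover signed_quotient) : bip_graph E :=
  match p.1 with inl u => inl (hX (u, p.2)) | inr v => inr (hY (v, p.2)) end.
pose g (z : bip_graph E) : double_cover signed_quotient :=
  match z with
  | inl x => (inl (gX x).1, (gX x).2)
  | inr y => (inr (gY y).1, (gY y).2)
  end.
exists f.
  exists g => [[[u|v] b]|[x|y]]; rewrite /f /g /= ?hXK ?hYK //.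
    by rewrite -surjective_pairing gXK.
  by rewrite -surjective_pairing gYK.
case=> [[u|v] b] [[u'|v'] b'] //=; rewrite /dc_adj /f //=.
  exact: quotient_adjE.
by rewrite quotient_adjE setUC [b' == b]eq_sym.
Qed.

Lemma edge_num_quotient :
  bijective hX -> bijective hY ->
  2 * edge_num signed_quotient = edge_num (bip_graph E).
Proof.
move=> bijX bijY; rewrite !edge_num_bip (reindex hX) /=; last exact: onW_bij.
rewrite sum_pair_bool big_distrr /=; apply: eq_bigr => u _.
(* Either lift of [u] sees exactly one lift of each neighbour [v]; the two lifts of [u] account for
   the factor 2. *)
have sum_y b : \sum_y E (hX (u, b)) y = \sum_v quotient_adj u v.
  rewrite (reindex hY) /=; last exact: onW_bij.
  rewrite sum_pair_bool; apply: eq_bigr => v _.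
  have := E_simple u v; rewrite /quotient_adj.
  case: b; last rewrite -!(E_neg u v false) /=.
    by case: (E _ (hY (v, true))); case: (E _ (hY (v, false))).
  by case: (E _ (hY (v, true))); case: (E _ (hY (v, false))).
by rewrite !sum_y mul2n addnn.
Qed.
End SignedQuotient.

(** * Numerical identities and assembly *)

Lemma edge_num_clone (X Y : finType) (E : X -> Y -> bool) r :
  edge_num (clone E r) = r * edge_num (bip_graph E).
Proof.
rewrite !edge_num_bip -(pair_bigA _ (fun x (i : 'I_r) => \sum_y E x y)) big_distrr /=.
by apply: eq_bigr => x _; rewrite sum_nat_const card_ord.
Qed.

Lemma natr_half (m n : nat) : 2 * m = n -> (m%:R = n%:R / 2%:R :> rat)%R.
Proof. by move=> <-; rewrite mulnC natrM mulfK. Qed.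

Theorem theorem2p8 (k r : nat) (X Y : finType) (E : X -> Y -> bool)
    (hk : 3 <= k) (hr : 1 <= r <= k - 1)
    (hgirth : girth_gt (2 * k) (bip_graph E)) :
  cycle_free (2 * k) (clone E r) /\
  (forall (aX : X -> X) (aY : Y -> Y),
     involutive aX -> (forall x, aX x <> x) ->
     involutive aY -> (forall y, aY y <> y) ->
     (forall x y, E x y <-> E (aX x) (aY y)) ->
     (forall x y, ~ (E x y /\ E x (aY y))) ->
     exists Q : signed_graph,
       bipartite Q /\
       sg_iso (double_cover Q) (clone E r) /\
       ((vertex_num Q)%:R = (r%:R * #|X|%:R + #|Y|%:R) / 2%:R :> rat)%R /\
       ((edge_num Q)%:R = (r%:R * (edge_num (bip_graph E))%:R) / 2%:R :> rat)%R /\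
       pos_cycle_free (2 * k) Q).
Proof.
have k_gt0 : 0 < k by apply: leq_trans hk.
(* Subtraction is truncated, so positivity of [k] is needed here. *)
have r_lt_k : r < k by case/andP: hr => _; rewrite -ltnS subn1 prednK.
have freeB := clone_cycle_free k_gt0 r_lt_k hgirth; split=> //.
move=> aX aY aXK aX_free aYK aY_free E_inv E_simple.
(* The involution on clones keeps the index, so it inherits freeness from [aX]. *)
pose aXr (p : X * 'I_r) := (aX p.1, p.2).
have aXrK : involutive aXr by case=> x i; rewrite /aXr /= aXK.
have aXr_free p : aXr p <> p by case: p => x i [/aX_free].
have [X' [hX [bijX hX_neg]]] := involution_halves aXrK aXr_free.
have [Y' [hY [bijY hY_neg]]] := involution_halves aYK aY_free.
pose Er (p : X * 'I_r) y := E p.1 y.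
have Er_neg u v b c :
    Er (hX (u, ~~ b)) (hY (v, ~~ c)) = Er (hX (u, b)) (hY (v, c)).
  by rewrite hX_neg hY_neg; apply/idP/idP => [H|/E_inv] //; apply/E_inv.
have Er_simple u v :
    ~~ (Er (hX (u, true)) (hY (v, true)) && Er (hX (u, true)) (hY (v, false))).
  (* The two lifts of [v] are exchanged by [aY], so this is condition (ii). *)
  by apply/negP=> /andP; rewrite (hY_neg v true); apply: E_simple.
have isoQ := double_cover_quotient Er_neg Er_simple bijX bijY.
exists (signed_quotient Er hX hY); split.
  exists (fun w : X' + Y' => if w is inl _ then true else false).
  by case=> [u|v] [u'|v'].
split; first exact: isoQ.
split.
  rewrite -natrM -natrD; apply: natr_half.
  rewrite /vertex_num card_sum mulnDr mulnC (mulnC 2) -card_bool -!card_prod.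
  by rewrite (bij_eq_card bijX) (bij_eq_card bijY) card_prod card_ord mulnC.
split; last exact: double_cover_pos_cycle_free isoQ freeB.
rewrite -natrM; apply: natr_half.
by rewrite -edge_num_clone (edge_num_quotient Er_neg Er_simple bijX bijY).
Qed.
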